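(* Let $n\ge 1$ and $k\ge 0$ be integers and let $\alpha=(a_1,\ldots,a_n)\in PP_n$. Then $\alpha\in PF_{n,k}$ if and only if, for every maximal interval $[p,q]\subseteq U_\alpha$, there exists $J\subseteq[n]$ such that $a_j\in[p,\,p-2+|J|]$ for all $j\in J$, and $\tau_{p-2}(\alpha_{|_J})\in PF_{|J|,k}$ is a complete $k$-Naples parking function (i.e. it is a complete parking preference of length $|J|$ that belongs to $PF_{|J|,k}$).
   Context: For integers $a\le b$, $[a,b]=\{a,a+1,\ldots,b\}$ (empty if $a>b$) and $[n]=[1,n]$. A parking preference of length $n$ is a tuple $\alpha=(a_1,\ldots,a_n)$ with entries in $[n]$; $PP_n$ is the set of these. Cars $c_1,\ldots,c_n$ arrive in this order at a one-way street with spots $1,\ldots,n$, and $a_i$ is the preferred spot of $c_i$. $k$-Naples parking rule: car $c_i$ parks in spot $a_i$ if it is free; otherwise it checks one at a time the spots $a_i-1,a_i-2,\ldots,a_i-k$ (only those that are $\ge 1$), parking in the first free one found; if none is free, it proceeds forward and parks in the first free spot $>a_i$, if any; otherwise it fails to park. $PF_{n,k}$, the set of $k$-Naples parking functions of length $n$, is the set of $\alpha\in PP_n$ for which all cars park under this rule. $|\alpha|_i$ is the number of indices $h$ with $a_h=i$. The excess function is $u_\alpha(j)=\sum_{i=j}^n|\alpha|_i-(n-j+1)$ for $j\in[n]$, and $U_\alpha=\{j\in[n] : u_\alpha(j)\ge 1\}$ (note $1\notin U_\alpha$). A maximal interval $[p,q]\subseteq U_\alpha$ is a nonempty interval of consecutive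 integers contained in $U_\alpha$ that is maximal under inclusion. For $n\ge 2$, $\alpha\in PP_n$ is complete if $U_\alpha=[2,n]$ (completeness is only defined for length at least $2$). For $w\in\mathbb Z$ the $w$-shift of a tuple $(b_1,\ldots,b_h)$ is $\tau_w(b_1,\ldots,b_h)=(b_1-w,\ldots,b_h-w)$. For $J=\{j_1<\cdots<j_h\}\subseteq[n]$, the restriction is $\alpha_{|_J}=(a_{j_1},\ldots,a_{j_h})$. *)

(* Defs.v *)
(** Parking preferences are tuples of 1-based spot numbers in [nat]; cars are
    indexed by ['I_n], in order of arrival. *)
From mathcomp Require Import all_boot all_order all_algebra.

Set Implicit Arguments.
Unset Strict Implicit.
Unset Printing Implicit Defensive.

Import GRing.Theory Num.Theory.

Definition nat_itv (a b : nat) : pred nat := [pred i | a <= i <= b].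

Definition PP (n : nat) : pred (n.-tuple nat) :=
  [pred alpha | all [in nat_itv 1 n] (alpha : n.-tuple nat)].
Arguments PP n : clear implicits.

(** Spots in the order in which a car with preference [a] checks them:
    [a], then those of [a - 1], ..., [a - k] that are [>= 1], then
    [a + 1], ..., [n]. *)
Definition checked_spots (n k a : nat) : seq nat :=
  a :: [seq a - i | i <- iota 1 k & i < a] ++ iota a.+1 (n - a).

Definition parking_spot (n k : nat) (occupied : seq nat) (a : nat) : option nat :=
  ohead [seq s <- checked_spots n k a | s \notin occupied].

Fixpoint all_park (n k : nat) (occupied prefs : seq nat) : bool :=
  if prefs is a :: prefs' then
    if parking_spot n k occupied a is Some s
    then all_park n k (s :: occupied) prefs'
    else false
  else true.

Definition PF (n k : nat) : pred (n.-tuple nat) :=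
  [pred alpha | (alpha \in PP n) && all_park n k [::] alpha].
Arguments PF n k : clear implicits.

Definition excess (n : nat) (alpha : n.-tuple nat) (j : nat) : int :=
  ((\sum_(j <= i < n.+1) count_mem i alpha)%:Z - (n%:Z - j%:Z + 1))%R.

Definition U (n : nat) (alpha : n.-tuple nat) : pred nat :=
  [pred j | (j \in nat_itv 1 n) && (1 <= excess alpha j)%R].

Definition maximal_interval (p q : nat) (S : pred nat) : Prop :=
  [/\ p <= q,
      {subset nat_itv p q <= S} &
      forall p' q' : nat,
        {subset nat_itv p' q' <= S} ->
        {subset nat_itv p q <= nat_itv p' q'} ->
        nat_itv p' q' =i nat_itv p q].

Definition complete (n : nat) (alpha : n.-tuple nat) : Prop :=
  [/\ 2 <= n, alpha \in PP n & U alpha =i nat_itv 2 n].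

(** Subtraction on [nat] is truncated, so this is the [w]-shift only for
    tuples whose entries are all at least [w]. *)
Definition shift (w h : nat) (b : h.-tuple nat) : h.-tuple nat :=
  [tuple of [seq x - w | x <- b]].

(** The entries [tnth alpha j] for [j] in [J], by increasing [j]: [enum] lists
    ordinals in increasing order. *)
Definition restriction (n : nat) (alpha : n.-tuple nat) (J : {set 'I_n}) :
    #|J|.-tuple nat :=
  [tuple of [seq tnth alpha j | j in J]].

(* Main.v *)
(** Let the street be infinite to the right, so that every car parks, say car
    [i] in [s i]; then [alpha] is a parking function iff [s i <= n] for all [i].

    If some car parks beyond [n], let [e] be the least spot of [[1, n]] left
    empty. No car crosses [e], so [e + 1] starts a maximal interval. Along the
    cars of the corresponding [J], every spot taken when [J] parks alone is
    already taken in the full process; but [J] alone fills [e], a contradiction.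

    Conversely, let all cars park in [[1, n]] and let [p] start a maximal
    interval. The first car with preference [>= p] to park below [p] parks in
    [p - 1]; it closes a block [[p - 1, R]] filled by cars with preferences in
    [[p, R]]. For the least such [R] these cars form a complete [J]: at the
    largest spot [j] where completeness fails, no car can have crossed from
    [>= j] to [< j], so [[p - 1, j - 1]] would be a smaller block. *)
Require Import Defs.
From mathcomp Require Import all_boot all_order all_algebra.
From mathcomp Require Import zify.

Set Implicit Arguments.
Unset Strict Implicit.
Unset Printing Implicit Defensive.

(** * Parking on a street without right end *)

(** Car with preference [a] takes spot [s] of a street without right end, the
    spots in [occ] being occupied. *)
Definition parks (k : nat) (occ : pred nat) (a s : nat) : Prop :=
  [/\ 0 < s, ~~ occ s &
      (s <= a <= s + k /\ forall t, s < t <= a -> occ t) \/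
      (a < s /\ forall t, 0 < t < s -> a <= t + k -> occ t)].

Lemma eq_parks k (occ1 occ2 : pred nat) a s :
  occ1 =1 occ2 -> parks k occ1 a s -> parks k occ2 a s.
Proof.
move=> e [s0 sF h]; split => //; first by rewrite -e.
by case: h => -[h1 h2]; [left|right]; split => // t; rewrite -e; apply: h2.
Qed.

Lemma parks_exists k (occ : seq nat) a : 0 < a -> exists s, parks k [in occ] a s.
Proof.
move=> a0; pose P s := [&& 0 < s, s <= a <= s + k & s \notin occ].
have Pa s : P s -> s <= a by rewrite /P => /and3P[_ /andP[]].
have [/existsP[x Px]|nP] := boolP [exists x : 'I_a.+1, P x].
  case: (@ex_maxnP P a (ex_intro _ (x : nat) Px) Pa) => s /and3P[s0 /andP[sa sk] sF] smax.
  exists s; split => //; left; split; first by rewrite sa.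
  move=> t /andP[st ta]; apply/negPn/negP => /= tF.
  suff: t <= s by lia.
  by apply: smax; rewrite /P tF; lia.
pose Q s := (a < s) && (s \notin occ).
have exQ : exists s, Q s.
  (* This spot lies beyond [a] and beyond every occupied spot. *)
  exists (a + \max_(x <- occ) x).+1; rewrite /Q; apply/andP; split; first by lia.
  apply/negP => h.
  have : (a + \max_(x <- occ) x).+1 <= \max_(x <- occ) x.
    exact: (@leq_bigmax_seq _ occ xpredT id _ h isT).
  lia.
case: (ex_minnP exQ) => s /andP[sa sF] smin.
exists s; split => //; first by lia.
right; split => // t /andP[t0 ts] tk; apply/negPn/negP => /= tF.
have [ta|ta] := leqP t a; last by have := smin t; rewrite /Q ta tF => /(_ isT); lia.
move/negP: nP; apply; apply/existsP; exists (inord t).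
by rewrite /P inordK ?ltnS // t0 ta tk tF.
Qed.

Lemma first_free (occ l1 l2 : seq nat) s :
  {subset l1 <= occ} -> s \notin occ ->
  ohead [seq t <- l1 ++ s :: l2 | t \notin occ] = Some s.
Proof.
move=> h sF; rewrite filter_cat /= sF.
suff -> : [seq t <- l1 | t \notin occ] = [::] by [].
by apply/eqP; rewrite -[_ == _]negbK -has_filter; apply/hasPn => t /h ->.
Qed.

(** Every spot checked before [s] is occupied, so [s] comes out first if it is on the finite street;
    if [s > n], the whole list of checked spots is occupied. *)
Lemma parking_spot_parks n k (occ : seq nat) a s :
  0 < a <= n -> parks k [in occ] a s ->
  parking_spot n k occ a = if s <= n then Some s else None.
Proof.
move=> /andP[a0 an] [s0 sF [[/andP[sa sk] h]|[sa h]]]; rewrite /parking_spot /checked_spots.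
  have -> : s <= n by lia.
  have [e|sna] := eqVneq s a; first by rewrite -e (@first_free _ [::]).
  (* Cuts the backward steps just before step [a - s], the one that reaches [s]. *)
  rewrite (_ : k = (a - s).-1 + (k - (a - s)).+1); last by lia.
  rewrite iotaD (_ : 1 + _ = a - s); last by lia.
  rewrite filter_cat map_cat [iota (a - s) _]/= [filter _ (_ :: _)]/=.
  rewrite (_ : a - s < a); last by lia.
  rewrite [map _ (_ :: _)]/= subKn // -catA cat_cons -cat_cons.
  apply: first_free => // t.
  rewrite inE => /orP[/eqP ->|/mapP[i]]; first by apply: h; lia.
  by rewrite mem_filter mem_iota => hi ->; apply: h; lia.
have hb t : t \in a :: [seq a - i | i <- iota 1 k & i < a] -> t \in occ.
  rewrite inE => /orP[/eqP ->|/mapP[i]]; first by apply: h; lia.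
  by rewrite mem_filter mem_iota => hi ->; apply: h; lia.
rewrite -cat_cons; case: leqP => sn.
  rewrite (_ : n - a = (s - a.+1) + (n - s).+1); last by lia.
  rewrite iotaD catA (_ : a.+1 + (s - a.+1) = s); last by lia.
  apply: first_free => // t; rewrite mem_cat => /orP[/hb //|].
  by rewrite mem_iota => ht; apply: h; lia.
suff -> : [seq t <- (a :: [seq a - i | i <- iota 1 k & i < a]) ++ iota a.+1 (n - a)
            | t \notin occ] = [::] by [].
apply/eqP; rewrite -[_ == _]negbK -has_filter; apply/hasPn => t.
rewrite mem_cat negbK => /orP[/hb //|].
by rewrite mem_iota => ht; apply: h; lia.
Qed.

(** * The whole process, recorded by the spots finally taken *)

Definition occupied n (s : 'I_n -> nat) (i : nat) : pred nat :=
  fun t => [exists j : 'I_n, (j < i) && (s j == t)].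

(** The outcome [s] alone encodes the process: indices follow the order of arrival, so the street
    met by car [i] is read off from the cars before it. *)
Definition parks_at k n (a s : 'I_n -> nat) : Prop :=
  forall i : 'I_n, parks k (occupied s i) (a i) (s i).

Lemma occupiedP n (s : 'I_n -> nat) (i t : nat) :
  reflect (exists2 j : 'I_n, j < i & s j = t) (occupied s i t).
Proof.
apply: (iffP existsP) => [[j /andP[ji /eqP e]]|[j ji <-]]; first by exists j.
by exists j; rewrite ji eqxx.
Qed.

Lemma parks_at_exists k n (a : 'I_n -> nat) :
  (forall i, 0 < a i) -> exists s, parks_at k a s.
Proof.
move=> a0.
suff /(_ n (leqnn n)) [s hs] : forall m, m <= n ->
    exists s : 'I_n -> nat, forall i : 'I_n, i < m -> parks k (occupied s i) (a i) (s i).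
  by exists s => i; apply: hs.
(* [0] is a placeholder for cars not yet treated; the condition at [i < m] reads [s] only up to
   [i]. *)
elim=> [|m IH] mn; first by exists (fun=> 0).
have [s hs] := IH (ltnW mn).
pose om := Ordinal mn.
have [x hx] := parks_exists k [seq s j | j in [pred j : 'I_n | j < m]] (a0 om).
pose s' i := if i == om then x else s i.
have s'E (i : 'I_n) : i < m -> s' i = s i.
  by move=> im; rewrite /s' ifN //; apply/eqP => e; move: im; rewrite e /= ltnn.
have occE (i : nat) : i <= m -> occupied s i =1 occupied s' i.
  move=> im t; apply: eq_existsb => j; case: ltnP => //= ji.
  by rewrite s'E // (leq_trans ji).
exists s' => i; rewrite ltnS leq_eqVlt => /orP[/eqP im|im]; last first.
  by rewrite s'E //; apply: eq_parks (hs i im); apply: occE; apply: ltnW.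
have -> : i = om by apply: val_inj.
rewrite {2}/s' eqxx; apply: eq_parks hx => t; rewrite -occE //=.
apply/mapP/occupiedP => [[j]|[j jm <-]].
  by rewrite mem_enum => jm ->; exists j.
by exists j => //; rewrite mem_enum.
Qed.

Lemma all_park_parks_at k n (b : n.-tuple nat) (s : 'I_n -> nat) :
  b \in PP n -> parks_at k (tnth b) s ->
  all_park n k [::] b = [forall i, s i <= n].
Proof.
move=> /allP bP hs.
(* Invariant: when the cars from [i] on remain, [occ] holds exactly the spots of the cars before
   [i]. *)
suff H d (i : nat) occ : n - i = d -> i <= n -> [in occ] =1 occupied s i ->
    all_park n k occ (drop i b) = [forall j : 'I_n, (i <= j) ==> (s j <= n)].
  rewrite -{1}(drop0 b) (H n) ?subn0 //.
  by move=> t; apply/esym/negbTE/occupiedP => -[].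
elim: d i occ => [|d IH] i occ dE ni occE.
  rewrite drop_oversize ?size_tuple; last by lia.
  by apply/esym/forallP => j; have := ltn_ord j; case: leqP => //; lia.
have ltin : i < n by lia.
pose oi := Ordinal ltin.
rewrite (drop_nth 0) ?size_tuple //= -(tnth_nth 0 b oi).
rewrite (@parking_spot_parks _ _ _ _ (s oi)); first last.
- by apply: eq_parks (hs oi) => t; rewrite -occE.
- by have := bP _ (mem_tnth oi b); rewrite inE.
case: ifPn => sn; last first.
  by apply/esym/negbTE/forallPn; exists oi; rewrite negb_imply leqnn.
rewrite IH //; last 2 first.
- by lia.
- move=> t; rewrite /= inE; apply/orP/occupiedP => [[/eqP ->|]|[j]].
  + by exists oi.
  + by move: (occE t) => /= -> /occupiedP[j ji <-]; exists j => //; lia.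
  + rewrite ltnS leq_eqVlt => /orP[/eqP ji <-|ji <-].
      by left; rewrite (_ : j = oi) //; apply: val_inj.
    by right; move: (occE (s j)) => /= ->; apply/occupiedP; exists j.
apply/forallP/forallP => h j; apply/implyP => ij.
  have [e|e] := eqVneq j oi; first by rewrite e.
  apply: (implyP (h j)); move/eqP: e => e; rewrite ltn_neqAle ij andbT.
  by apply/eqP => e2; apply: e; apply: val_inj.
by apply: (implyP (h j)); lia.
Qed.

(** * Spots that a car passes over *)

Lemma parks_at_inj k n (a s : 'I_n -> nat) : parks_at k a s -> injective s.
Proof.
move=> hs i j e; apply: val_inj; case: (ltngtP i j) => // ij.
  by have [_ /occupiedP[]] := hs j; exists i.
by have [_ /occupiedP[]] := hs i; exists j.
Qed.

Lemma parks_at_back k n (a s : 'I_n -> nat) (i : 'I_n) t :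
  parks_at k a s -> s i < t <= a i -> exists2 j : 'I_n, j < i & s j = t.
Proof.
by move=> hs ht; have [_ _ [[_ h]|[? _]]] := hs i; [apply/occupiedP/h|lia].
Qed.

Lemma parks_at_forward k n (a s : 'I_n -> nat) (i : 'I_n) t :
  parks_at k a s -> a i < s i -> 0 < t < s i -> a i <= t + k ->
  exists2 j : 'I_n, j < i & s j = t.
Proof.
move=> hs ai ht tk; have [_ _ [[? _]|[_ h]]] := hs i; first by lia.
by apply/occupiedP/h.
Qed.

(** If [s z < s x], then [z] backs past spot [s x], hence comes after [x]; but
    [x] went forward only after the [k] spots that [z] could reach were full. *)
Lemma no_exchange k n (a s : 'I_n -> nat) (x z : 'I_n) :
  parks_at k a s -> a x < s x -> s x <= a z -> s x <= s z.
Proof.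
move=> hs ax az; rewrite leqNgt; apply/negP => sz.
have sI := parks_at_inj hs.
have xz : x < z.
  have [|j jz /sI <- //] := parks_at_back (t := s x) hs (_ : s z < s x <= a z).
  by rewrite sz.
have [z0 _ [[hz _]|[hz _]]] := hs z; last by lia.
have [|||j jx /sI e] := parks_at_forward (i := x) (t := s z) hs; try lia.
by subst j; lia.
Qed.

(** * Counting cars by their spots *)

Lemma card_spots_le n (s : 'I_n -> nat) l r :
  injective s -> #|[set i | l <= s i < r]| <= r - l.
Proof.
move=> sI; rewrite cardE -(size_map s) -(size_iota l (r - l)).
apply: uniq_leq_size; first by rewrite map_inj_uniq // enum_uniq.
by move=> t /mapP[i]; rewrite mem_enum inE mem_iota => hi ->; lia.
Qed.

Lemma card_spots n (s : 'I_n -> nat) l r :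
  injective s -> (forall t, l <= t < r -> exists i, s i = t) ->
  #|[set i | l <= s i < r]| = r - l.
Proof.
move=> sI h; rewrite cardE -(size_map s) -(size_iota l (r - l)).
apply: perm_size; apply: uniq_perm; rewrite ?map_inj_uniq ?enum_uniq ?iota_uniq //.
move=> t; rewrite mem_iota; apply/mapP/idP => [[i]|ht].
  by rewrite mem_enum inE => hi ->; lia.
have [|i e] := h t; first by lia.
by exists i => //; rewrite mem_enum inE e; lia.
Qed.

Lemma spots_onto n (s : 'I_n -> nat) t :
  injective s -> (forall i, 0 < s i <= n) -> 0 < t <= n -> exists i, s i = t.
Proof.
move=> sI sb ht.
have [] := @uniq_min_size _ [seq s i | i <- enum 'I_n] (iota 1 n).
- by rewrite map_inj_uniq // enum_uniq.
- by move=> x /mapP[i _ ->]; rewrite mem_iota; have := sb i; lia.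
- by rewrite size_map size_enum_ord size_iota.
move=> _ /(_ t); rewrite mem_iota ltnS ht => /mapP[i _ ->].
by exists i.
Qed.

(** * The excess function and the start of a maximal interval *)

Lemma sum_count_mem n (b : n.-tuple nat) j :
  b \in PP n ->
  \sum_(j <= i < n.+1) count_mem i b = #|[set h | j <= tnth b h]|.
Proof.
move=> /allP bP.
rewrite (eq_bigr (fun i => \sum_(h < n) (tnth b h == i : nat))) => [|i _]; last first.
  rewrite -sum1_count big_mkcond big_tuple /=.
  by apply: eq_bigr => h _; case: eqP.
rewrite exchange_big /= -sum1_card [RHS]big_mkcond /=; apply: eq_bigr => h _.
have := bP _ (mem_tnth h b); rewrite !inE => /andP[h0 hn].
case: leqP => jh.
  rewrite (bigD1_seq (tnth b h)) ?iota_uniq ?mem_index_iota ?jh //= eqxx big1 // => i /negbTE ne.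
  by rewrite eq_sym ne.
rewrite big_nat_cond big1 // => i; case: eqP => // <-; lia.
Qed.

Lemma mem_U n (b : n.-tuple nat) j :
  b \in PP n ->
  (j \in U b) = (0 < j <= n) && (n - j + 1 < #|[set h | j <= tnth b h]|).
Proof.
move=> bP; rewrite inE /= /excess (sum_count_mem _ bP) !inE.
by move: #|_| => c; apply/andP/andP => -[/andP[h1 h2] h3]; rewrite h1 h2; split => //; lia.
Qed.

(** From [p] to [p - 1] the excess changes by the number of preferences [p - 1], minus 1. Since it
    falls from at least 1 to at most 0, it is exactly 1 at [p], and nobody prefers [p - 1]. *)
Lemma U_start n (b : n.-tuple nat) p q :
  b \in PP n -> maximal_interval p q (U b) ->
  [/\ 1 < p <= n, #|[set h | p <= tnth b h]| = n - p + 2 &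
      forall h, tnth b h != p.-1].
Proof.
move=> bP [pq sub max].
have bP1 h : 0 < tnth b h <= n.
  by have /allP/(_ _ (mem_tnth h b)) := bP; rewrite !inE.
have pU : p \in U b by apply: sub; rewrite !inE; lia.
have := pU; rewrite (mem_U _ bP) => /andP[hp pc].
have p1 : 1 < p.
  rewrite ltnNge; apply/negP => p1; have := max_card [set h | p <= tnth b h].
  by rewrite card_ord; lia.
have pN : p.-1 \notin U b.
  apply/negP => h.
  have sub' : {subset nat_itv p.-1 q <= U b}.
    move=> t; rewrite [t \in _]inE /= => ht; have [->//|e] := eqVneq t p.-1.
    by apply: sub; rewrite !inE; lia.
  have le : {subset nat_itv p q <= nat_itv p.-1 q} by move=> t; rewrite !inE; lia.
  by have := max _ _ sub' le p.-1; rewrite !inE; lia.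
have sc : [set h | p <= tnth b h] \subset [set h | p.-1 <= tnth b h].
  by apply/subsetP => h; rewrite !inE; lia.
have := subset_leq_card sc.
move: pN; rewrite (mem_U _ bP) => pN le; split; try lia.
have e : [set h | p <= tnth b h] = [set h | p.-1 <= tnth b h].
  by apply/eqP; rewrite eqEcard sc; lia.
move=> h; apply/negP => /eqP eh.
by move/setP/(_ h): e; rewrite !inE eh; lia.
Qed.

Lemma maximal_interval_from n (b : n.-tuple nat) p :
  p \in U b -> p.-1 \notin U b -> exists q, maximal_interval p q (U b).
Proof.
move=> pU pN.
have Un t : t \in U b -> t <= n by rewrite !inE => /andP[/andP[]].
pose P q := (p <= q <= n) && all [in U b] (iota p (q - p).+1).
have exP : exists q, P q by exists p; rewrite /P leqnn Un //= subnn /= pU.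
have Pn q : P q -> q <= n by case/andP => /andP[].
case: (ex_maxnP exP Pn) => q /andP[/andP[pq qn] /allP hq] qmax.
have sub : {subset nat_itv p q <= U b}.
  by move=> t ht; apply: hq; rewrite mem_iota; move: ht; rewrite !inE; lia.
exists q; split => // p' q' sub' le.
have hp : p' <= p <= q' by apply: le; rewrite !inE; lia.
have hq' : p' <= q <= q' by apply: le; rewrite !inE; lia.
have pp : p' = p.
  apply/eqP; rewrite eqn_leq; apply/andP; split; first by lia.
  rewrite leqNgt; apply/negP => lt; move/negP: pN; apply.
  by apply: sub'; rewrite !inE; lia.
subst p'; suff -> : q' = q by [].
apply/eqP; rewrite eqn_leq; apply/andP; split; last by lia.
apply: qmax; apply/andP; split.
  by rewrite Un ?andbT; [lia|apply: sub'; rewrite !inE; lia].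
by apply/allP => t; rewrite mem_iota => ht; apply: sub'; rewrite !inE; lia.
Qed.

(** * Restriction to a set of cars *)

Lemma tnth_shift_restriction n (b : n.-tuple nat) (J : {set 'I_n}) w (h : 'I_#|J|) :
  tnth (shift w (restriction b J)) h = tnth b (enum_val h) - w.
Proof.
rewrite /shift tnth_map (tnth_nth 0) /= /restriction /=; congr (_ - w).
by rewrite (nth_map (enum_val h)) -?cardE // -enum_val_nth.
Qed.

(** Lets the processes of [J] alone and of all cars be compared car by car. *)
Lemma ltn_enum_val n (J : {set 'I_n}) (h h' : 'I_#|J|) :
  (enum_val h < enum_val h') = (h < h').
Proof.
have mono (x y : 'I_#|J|) : x < y -> enum_val x < enum_val y.
  move=> xy; have srt : sorted ltn (map val (enum J)).
    rewrite {1}/enum_mem -enumT sorted_map; apply: sorted_filter.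
      by move=> ? ? ?; apply: ltn_trans.
    by rewrite -sorted_map val_enum_ord iota_ltn_sorted.
  have d := enum_val x; rewrite !(enum_val_nth d).
  have sz (z : 'I_#|J|) : z < size (enum J) by rewrite -cardE.
  have := sorted_ltn_nth ltn_trans 0 srt x y.
  rewrite !inE size_map !sz => /(_ isT isT xy).
  by rewrite !(nth_map d).
apply/idP/idP => [|/mono //]; rewrite ltnNge => lt; rewrite ltnNge; apply: contra lt.
by rewrite leq_eqVlt => /orP[/eqP/val_inj -> //|/mono/ltnW].
Qed.

(** Truncated subtraction sends small entries to [0], which [0 < j] keeps out of the count. *)
Lemma card_shift_restriction n (b : n.-tuple nat) (J : {set 'I_n}) w j :
  0 < j ->
  #|[set h | j <= tnth (shift w (restriction b J)) h]| =
  #|[set i in J | j + w <= tnth b i]|.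
Proof.
move=> j0; set S := [set h | _]; transitivity #|[set enum_val h | h in S]|.
  by rewrite card_imset //; apply: enum_val_inj.
apply: eq_card => i.
rewrite !inE; apply/imsetP/andP => [[h]|[iJ ji]].
  rewrite inE tnth_shift_restriction => hj ->; split; last by lia.
  exact: enum_valP.
exists (enum_rank_in iJ i); last by rewrite enum_rankK_in.
rewrite inE tnth_shift_restriction enum_rankK_in //. lia.
Qed.

(** Spots of the window are taken only by cars of [J], whose searches up to their final spots see
    the same occupation inside the window as in the full process. The shift [p - 2] moves the left
    end [p - 1] to spot 1. *)
Lemma parks_at_window k n (b : n.-tuple nat) (s : 'I_n -> nat) (J : {set 'I_n}) p R :
  parks_at k (tnth b) s -> 1 < p ->
  (forall i, (i \in J) = (p.-1 <= s i <= R)) ->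
  (forall i, i \in J -> p <= tnth b i <= R) ->
  parks_at k (tnth (shift (p - 2) (restriction b J)))
    (fun h => s (enum_val h) - (p - 2)).
Proof.
move=> hs p1 hJ ha h; set i := enum_val h; rewrite tnth_shift_restriction -/i.
have iJ : i \in J by apply: enum_valP.
have si : p.-1 <= s i <= R by rewrite -hJ.
have ai := ha i iJ.
have occ t : p.-1 <= t <= R -> (exists2 j : 'I_n, j < i & s j = t) ->
    occupied (fun h : 'I_#|J| => s (enum_val h) - (p - 2)) h (t - (p - 2)).
  move=> ht [j ji e]; have jJ : j \in J by rewrite hJ e.
  apply/occupiedP; exists (enum_rank_in jJ j); last by rewrite enum_rankK_in // e.
  by rewrite -ltn_enum_val enum_rankK_in.
split; first by lia.
  apply/negP => /occupiedP[h' lt e]; have e' : s (enum_val h') = s i.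
    by have := hJ (enum_val h'); rewrite enum_valP -/i in e *; lia.
  move/(parks_at_inj hs)/enum_val_inj: e' => e'; by rewrite e' ltnn in lt.
have [_ _ [[hi _]|[hi _]]] := hs i; [left|right]; split; try lia.
  move=> t ht; rewrite -(addnK (p - 2) t); apply: occ; first by lia.
  by apply: (parks_at_back hs); rewrite -/i; lia.
move=> t ht tk; rewrite -(addnK (p - 2) t); apply: occ; first by lia.
by apply: (parks_at_forward hs); rewrite -/i; lia.
Qed.

Lemma PF_parks_at k n (b : n.-tuple nat) (s : 'I_n -> nat) :
  b \in PP n -> parks_at k (tnth b) s -> b \in PF n k = [forall i, s i <= n].
Proof. by move=> bP hs; rewrite inE /= bP (all_park_parks_at bP hs). Qed.

Lemma PP_parks_at_exists k n (b : n.-tuple nat) :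
  b \in PP n -> exists s, parks_at k (tnth b) s.
Proof.
move=> /allP bP; apply: parks_at_exists => i.
by have := bP _ (mem_tnth i b); rewrite inE => /andP[].
Qed.

(** * Necessity: a complete block at each maximal interval *)

Lemma window_exists k n (b : n.-tuple nat) (s : 'I_n -> nat) p q :
  b \in PP n -> parks_at k (tnth b) s -> (forall i, s i <= n) ->
  maximal_interval p q (U b) ->
  exists R, p <= R <= n /\ forall i, p.-1 <= s i <= R -> p <= tnth b i <= R.
Proof.
move=> bP hs sn pq; have [hp pc pN] := U_start bP pq.
have sI := parks_at_inj hs.
pose a := tnth b; have s0 i : 0 < s i by have [] := hs i.
(* [n - p + 2] cars prefer [[p, n]], which has one spot fewer. *)
have [c0 /andP[ac0 sc0]] : exists c, (p <= a c) && (s c < p).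
  apply/existsP; rewrite -[[exists _, _]]negbK negb_exists; apply/negP => /forallP h.
  have := card_spots_le p n.+1 sI; suff : [set h | p <= tnth b h] \subset [set i | p <= s i < n.+1].
    by move/subset_leq_card; rewrite pc; lia.
  by apply/subsetP => i; have := h i; rewrite !inE ltnS sn /a; lia.
pose c := [arg min_(i < c0 | (p <= a i) && (s i < p)) val i].
have [ac sc cmin] : [/\ p <= a c, s c < p & forall i, p <= a i -> s i < p -> c <= i].
  rewrite /c; case: arg_minnP => [|i /andP[? ?] hi]; first by rewrite ac0.
  by split => // i' h1 h2; apply: hi; rewrite h1.
(* Otherwise [c] backs past [p - 1], held by an earlier car [j]. Minimality of [c] and [pN] give
   [a j < p - 1], so [j] went forward, against [no_exchange]. *)
have scE : s c = p.-1.
  have [//|ne] := eqVneq (s c) p.-1.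
  have [|j jc sj] := parks_at_back (i := c) (t := p.-1) hs; first by rewrite -/a; lia.
  have [aj|aj] := leqP p (a j); first by have := cmin j aj; lia.
  have := pN j; have := no_exchange (x := j) (z := c) hs; rewrite -/(a j) -/(a c); lia.
(* [R] will be the greatest [r] such that [[p, r]] is full when [c] arrives. *)
pose F r := (p <= r <= n) && [forall t : 'I_n.+1, (p <= t <= r) ==> occupied s c t].
have fullP r t : F r -> p <= t <= r -> exists2 j : 'I_n, j < c & s j = t.
  move=> /andP[hr /forallP h] ht; apply/occupiedP.
  by have := h (inord t); rewrite inordK ?ht //; lia.
have ltc : a c <= n by have /allP/(_ _ (mem_tnth c b)) := bP; rewrite !inE => /andP[].
have Fa : F (a c).
  rewrite /F ac ltc; apply/forallP => t; apply/implyP => ht; apply/occupiedP.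
  by apply: (parks_at_back hs); rewrite -/a; lia.
have Fn r : F r -> r <= n by case/andP => /andP[].
case: (ex_maxnP (ex_intro F _ Fa) Fn) => R FR Rmax.
have acR := Rmax _ Fa; have Rn := Fn _ FR.
exists R; split; first by lia.
move=> i hi; rewrite -/(a i); have [->|ic] := eqVneq i c; first by lia.
have si : s i <> p.-1 by rewrite -scE => /sI/eqP; apply/negP.
have [|j jc /sI e] := fullP R (s i) FR; first by lia.
(* Now [i] precedes [c]. A preference below [p] would require [p - 1] to be taken before [c]; one
   beyond [R] makes [i] back past [R + 1], so that [[p, R + 1]] is full too. *)
subst j; apply/andP; split.
  rewrite leqNgt; apply/negP => ai.
  have [|||j ji] := parks_at_forward (i := i) (t := p.-1) hs; rewrite -/(a i); try lia.
  by rewrite -scE => /sI e; subst j; lia.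
rewrite leqNgt; apply/negP => ai.
have ain : a i <= n by have /allP/(_ _ (mem_tnth i b)) := bP; rewrite !inE => /andP[].
suff : F R.+1 by move/Rmax; rewrite ltnn.
apply/andP; split; first by lia.
apply/forallP => t; apply/implyP => ht; apply/occupiedP.
have [tR|tR] := leqP t R; first by apply: (fullP R) => //; lia.
have [|j ji sj] := parks_at_back (i := i) (t := t) hs; first by rewrite -/a; lia.
by exists j => //; lia.
Qed.

Lemma complete_window k n (b : n.-tuple nat) (s : 'I_n -> nat) p q :
  b \in PP n -> parks_at k (tnth b) s -> (forall i, s i <= n) ->
  maximal_interval p q (U b) ->
  exists J : {set 'I_n},
    [/\ forall j, j \in J -> tnth b j \in nat_itv p (p - 2 + #|J|),
        shift (p - 2) (restriction b J) \in PF #|J| k &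
        complete (shift (p - 2) (restriction b J))].
Proof.
move=> bP hs sn pq; have [hp pc pN] := U_start bP pq.
have sI := parks_at_inj hs.
have s0 i : 0 < s i by have [] := hs i.
have onto t : 0 < t <= n -> exists i, s i = t.
  by apply: spots_onto => // i; rewrite s0 sn.
pose Q R := (p <= R <= n) &&
  [forall i, (p.-1 <= s i <= R) ==> (p <= tnth b i <= R)].
have exQ : exists R, Q R.
  have [R [hR h]] := window_exists bP hs sn pq.
  by exists R; rewrite /Q hR; apply/forallP => i; apply/implyP/h.
case: (ex_minnP exQ) => R /andP[hR /forallP QR] Rmin.
have [J JE] : exists J : {set 'I_n}, forall i, (i \in J) = (p.-1 <= s i <= R).
  by exists [set i | p.-1 <= s i <= R] => i; rewrite inE.
have aJ i : i \in J -> p <= tnth b i <= R by rewrite JE; apply/implyP/QR.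
have cardJ : #|J| = R - p + 2.
  have -> : #|J| = #|[set i | p.-1 <= s i < R.+1]|.
    by apply: eq_card => i; rewrite JE !inE ltnS.
  by rewrite card_spots => // [|t ht]; [lia|apply: onto; lia].
have cardJR : p - 2 + #|J| = R by lia.
pose b' := shift (p - 2) (restriction b J).
have b'P : b' \in PP #|J|.
  apply/allP => x /tnthP[h ->]; rewrite tnth_shift_restriction !inE.
  by have := aJ _ (enum_valP h); lia.
exists J; rewrite -/b'; split.
- by move=> j jJ; rewrite inE /= cardJR aJ.
- rewrite (PF_parks_at b'P (parks_at_window hs _ JE aJ)); last by lia.
  by apply/forallP => h; have := enum_valP h; rewrite JE; lia.
split => //; first by lia.
(* This bound is completeness at the shifted index [j - (p - 2)]. Index 2, that is spot [p], is
   automatic: all [R - p + 2] cars of [J] prefer at least [p]. *)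
have [/forallP good|/forallPn[j0 nj0]] := boolP [forall j : 'I_n.+1,
    (p < j <= R) ==> (R - j + 2 <= #|[set i in J | j <= tnth b i]|)].
  move=> j; rewrite (mem_U _ b'P) !inE.
  have [j1|j1] := leqP j 1.
    rewrite /=; apply/negbTE/negP => /andP[j0 h].
    by have := leq_trans h (max_card _); rewrite card_ord; lia.
  have [jJ|jJ] /= := leqP j #|J|; rewrite ?andbF //.
  rewrite (ltnW j1) /= card_shift_restriction; last by lia.
  have [j2|j2] := eqVneq j 2.
    suff -> : #|[set i in J | j + (p - 2) <= tnth b i]| = #|J| by rewrite j2 cardJ; lia.
    apply: eq_card => i; rewrite !inE; have := aJ i; case: (i \in J) => //= /(_ isT); lia.
  have := good (inord (j + (p - 2))); rewrite inordK; last by lia.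
  rewrite (_ : p < _ <= R) /=; last by lia.
  by rewrite cardJ => le; apply: leq_trans le; lia.
pose F j := (p < j <= R) && (#|[set i in J | j <= tnth b i]| < R - j + 2).
have exF : exists j, F j.
  by exists j0; move: nj0; rewrite negb_imply -ltnNge /F.
have FR j : F j -> j <= R by case/andP => /andP[].
case: (ex_maxnP exF FR) => j /andP[hj cj] jmax.
suff : Q j.-1 by move/Rmin; lia.
apply/andP; split; first by lia.
apply/forallP => z; apply/implyP => hz.
have zJ : z \in J by rewrite JE; lia.
have az := aJ z zJ; suff : tnth b z < j by lia.
rewrite ltnNge; apply/negP => ajz.
have spots y : p <= y <= R -> #|[set i in J | y <= s i]| = R.+1 - y.
  move=> hy; rewrite -(card_spots sI (l := y) (r := R.+1)) => [|t ht].
    by apply: eq_card => i; rewrite !inE JE; lia.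
  by apply: onto; lia.
(* At most [R - j + 1] cars of [J] prefer [>= j] and exactly that many park there; as [z] prefers
   [>= j] but parks below, some [x] crosses forward. *)
have [x xJ /andP[ax sx]] : exists2 x, x \in J & tnth b x < j <= s x.
  apply/exists_inP; rewrite -[[exists _ in _, _]]negbK negb_exists_in.
  apply/negP => /forall_inP h.
  have pr : [set i in J | j <= s i] \proper [set i in J | j <= tnth b i].
    apply/properP; split; last by exists z; rewrite !inE zJ //=; lia.
    apply/subsetP => i; rewrite !inE => /andP[iJ ji].
    by rewrite iJ; have := h i iJ; lia.
  by have := proper_card pr; rewrite spots; lia.
(* If [s x = j], then [x] and [z] contradict [no_exchange]. If [s x > j], maximality of [j] makes
   more cars of [J] prefer [>= s x] than park there; one of them, [w], parks below [s x], and [x]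
   and [w] give the contradiction. *)
have [e|ne] := eqVneq (s x) j.
  by have := no_exchange (x := x) (z := z) hs; lia.
have xR : s x <= R by move: xJ; rewrite JE; lia.
have nF : ~~ F (s x) by apply/negP => /jmax; lia.
have lt : #|[set i in J | s x <= s i]| < #|[set i in J | s x <= tnth b i]|.
  by rewrite spots; move: nF; rewrite /F; lia.
have [w] : exists w, w \in [set i in J | s x <= tnth b i] :\: [set i in J | s x <= s i].
  apply/set0Pn; rewrite setD_eq0; apply/negP => /subset_leq_card; lia.
rewrite !inE => /andP[h1 /andP[h2 h3]].
by have := no_exchange (x := x) (z := w) hs; rewrite h2 /= in h1; lia.
Qed.

(** * Sufficiency: an empty spot and the block that would fill it *)

(** Passing over or preferring the least empty spot [e] would fill it. So [e - 1] cars prefer less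
    than [e], the other [n - e + 1] prefer more, and the excess is 0 at [e] and 1 at [e + 1]. *)
Lemma first_empty_spot k n (b : n.-tuple nat) (s : 'I_n -> nat) :
  b \in PP n -> parks_at k (tnth b) s -> ~~ [forall i, s i <= n] ->
  exists e, [/\ 0 < e, forall i, s i != e, e.+1 \in U b & e \notin U b].
Proof.
move=> bP hs /forallPn[i0 si0].
have sI := parks_at_inj hs.
have s0 i : 0 < s i by have [] := hs i.
have bP1 h : 0 < tnth b h <= n.
  by have /allP/(_ _ (mem_tnth h b)) := bP; rewrite !inE.
pose E e := (0 < e <= n) && [forall i, s i != e].
have exE : exists e, E e.
  have [/existsP[e he]|/existsPn h] := boolP [exists e : 'I_n.+1, E e]; first by exists e.
  have cn : #|[set i | 1 <= s i < n.+1]| = n.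
    rewrite card_spots // ?subSS ?subn0 // => t ht.
    have := h (inord t); rewrite /E inordK ?(andP ht).2 //.
    rewrite (_ : 0 < t <= n) //= => /forallPn[i].
    by rewrite negbK => /eqP; exists i.
  have /eqP/setP/(_ i0) : [set i | 1 <= s i < n.+1] == setT.
    by rewrite eqEcard subsetT cardsT card_ord cn leqnn.
  by rewrite !inE; lia.
case: (ex_minnP exE) => e /andP[he /forallP hE] emin.
have full t : 0 < t < e -> exists i, s i = t.
  move=> ht; have [/existsP[i /eqP si]|/existsPn h] := boolP [exists i, s i == t].
    by exists i.
  have := emin t; rewrite /E (_ : 0 < t <= n) /=; last by lia.
  by move/(_ (introT forallP h)); lia.
have sep i : tnth b i != e /\ (tnth b i < e) = (s i < e).
  have := hE i; move=> /eqP sie.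
  have back : s i < e <= tnth b i -> False.
    by case/(parks_at_back hs) => j _ sj; have := hE j; rewrite sj eqxx.
  have fwd : tnth b i <= e < s i -> False.
    move=> h; have [|||j _ sj] := parks_at_forward (i := i) (t := e) hs; try lia.
    by have := hE j; rewrite sj eqxx.
  by split; lia.
have cardlt : #|[set i | tnth b i < e]| = e.-1.
  rewrite -subn1 -(card_spots sI (l := 1) (r := e)) //.
  by apply: eq_card => i; rewrite !inE s0 (sep i).2.
have card_ge : #|[set i | e <= tnth b i]| = n - e.-1.
  suff -> : [set i | e <= tnth b i] = ~: [set i | tnth b i < e].
    by have := cardsC [set i | tnth b i < e]; rewrite card_ord cardlt; lia.
  by apply/setP => i; rewrite !inE leqNgt.
have card_gt : #|[set i | e < tnth b i]| = n - e.-1.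
  by rewrite -card_ge; apply: eq_card => i; have := (sep i).1; rewrite !inE; lia.
have en : e < n.
  rewrite ltnNge; apply/negP => ne.
  have /card_gt0P[i] : 0 < #|[set i | e < tnth b i]| by rewrite card_gt; lia.
  by rewrite inE; have := bP1 i; lia.
exists e; split => //; first by lia.
  by rewrite (mem_U _ bP) card_gt; lia.
by rewrite (mem_U _ bP) card_ge; lia.
Qed.

(** Induction along the cars of [J]: what [J] alone has filled so far is, after translation by [w],
    already filled in the full process. *)
Lemma window_fills k n (b : n.-tuple nat) (s : 'I_n -> nat) (J : {set 'I_n}) w
    (s' : 'I_#|J| -> nat) :
  parks_at k (tnth b) s ->
  parks_at k (tnth (shift w (restriction b J))) s' ->
  (forall i, i \in J -> w.+1 < tnth b i) ->
  (forall i, s i != w.+1) ->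
  forall h : 'I_#|J|, exists2 i : 'I_n, i <= enum_val h & s i = s' h + w.
Proof.
move=> hs hs' hJ hw.
have sI := parks_at_inj hs.
suff H m (h : 'I_#|J|) : h < m -> exists2 i : 'I_n, i <= enum_val h & s i = s' h + w.
  by move=> h; apply: (H h.+1).
elim: m h => // m IH h hm; set i := enum_val h.
have early t : (exists2 h' : 'I_#|J|, h' < h & s' h' = t) ->
    exists2 j : 'I_n, j < i & s j = t + w.
  move=> [h' lt <-]; have [|j jh' sj] := IH h'; first by lia.
  by exists j => //; apply: leq_ltn_trans jh' _; rewrite ltn_enum_val.
have not_early t : (exists2 h' : 'I_#|J|, h' < h & s' h' = t) -> s i <> t + w.
  by move/early => [j ji <-] /sI e; rewrite e ltnn in ji.
have ai := hJ i (enum_valP h).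
have [s0' _ C'] := hs' h; have [s0 _ C] := hs i.
have tb := tnth_shift_restriction b w h; rewrite -/i in tb.
(* Parking lower would mean backing past [w + 1], which stays empty. *)
have siw : s i > w.
  rewrite ltnNge; apply/negP => le.
  have [|j _ sj] := parks_at_back (i := i) (t := w.+1) hs; first by lia.
  by have := hw j; rewrite sj eqxx.
have done_early t : (exists2 j : 'I_n, j < i & s j = t) ->
    exists2 j : 'I_n, j <= i & s j = t.
  by case=> j /ltnW; exists j.
(* When the spots differ, one of the two searches tried the other's spot first and found it taken.
   If the full search did, the claim holds; if the search of [J] alone did, induction makes [s i]
   taken before [i], which is absurd. *)
have [lt|gt|e] := ltngtP (s i) (s' h + w); last by exists i.
- have [le|gt] := leqP (s' h) (tnth b i - w).
    by apply/done_early/(parks_at_back hs); case: C; lia.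
  exfalso; apply: (not_early (s i - w)); last by lia.
  by apply: (parks_at_forward hs'); rewrite ?tb; case: C; lia.
- have [le|nle] := boolP (s i <= tnth b i).
    exfalso; apply: (not_early (s i - w)); last by lia.
    by apply: (parks_at_back hs'); rewrite tb; lia.
  by apply/done_early/(parks_at_forward hs); case: C'; rewrite ?tb; lia.
Qed.

Theorem theorem4p1 (n k : nat) (hn : 1 <= n)
    (alpha : n.-tuple nat) (halpha : alpha \in PP n) :
  alpha \in PF n k <->
  (forall p q : nat, maximal_interval p q (U alpha) ->
     exists J : {set 'I_n},
       [/\ forall j : 'I_n, j \in J ->
             tnth alpha j \in nat_itv p (p - 2 + #|J|),
           shift (p - 2) (restriction alpha J) \in PF #|J| k &
           complete (shift (p - 2) (restriction alpha J))]).
Proof.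
have [s hs] := PP_parks_at_exists k halpha.
rewrite (PF_parks_at halpha hs); split => [/forallP sn p q|hJ].
  exact: complete_window.
apply: contraT => /(first_empty_spot halpha hs) [e [e0 he eU eN]].
have [q /hJ [J [aJ bPF [J2 bP _]]]] := maximal_interval_from eU eN.
have [s' hs'] := PP_parks_at_exists k bP.
move: bPF; rewrite (PF_parks_at bP hs') => /forallP s'n.
have s'J h : 0 < s' h <= #|J| by have [-> _ _] := hs' h; rewrite s'n.
(* Here [p = e + 1], so the shift is by [e - 1] and spot 1 stands for [e]. *)
have [|h sh] := spots_onto (parks_at_inj hs') s'J (t := 1); first by lia.
have e2 : (e.+1 - 2).+1 = e by lia.
have [||i _ si] := window_fills (s := s) hs hs' _ _ h.
- by move=> i /aJ; rewrite inE e2 => /andP[].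
- by rewrite e2.
by have := he i; rewrite si sh add1n e2 eqxx.
Qed.
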